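(* Let $n\ge 1$ and let $W\subseteq\mathbb{R}$ be a finite nonempty subset. Let $X=(x_{ij})_{i,j=1}^n$ and $Y=(y_{ij})_{i,j=1}^n$ be symmetric matrices of indeterminates $\mathbf{x}=(x_{ij})_{i\le j}$ and $\mathbf{y}=(y_{ij})_{i\le j}$. Then the polynomial $\det(X)\ast_W\det(Y)\in\mathbb{R}[\mathbf{x},\mathbf{y}]$ is hyperbolic with respect to $\mathbf{e}=I\oplus\mathbf{0}$, i.e. the point $X=I$ (the $n\times n$ identity matrix), $Y=0$.
   Context: A homogeneous polynomial $h\in\mathbb{R}[x_1,\dots,x_m]$ is hyperbolic with respect to $\mathbf{e}\in\mathbb{R}^m$ if $h(\mathbf{e})\neq 0$ and for every $\mathbf{x}\in\mathbb{R}^m$ the univariate polynomial $t\mapsto h(t\mathbf{e}-\mathbf{x})$ has only real zeros. For a symmetric $n\times n$ matrix $A=(a_{ij})$ and $\mathbf{w}=(w_{ij})_{i<j}\in W^{\binom n2}$, the weighting $A^{\mathbf{w}}=(a^{\mathbf{w}}_{ij})$ is the symmetric matrix with $$a^{\mathbf{w}}_{ij}=w_{ij}a_{ij}\ \text{ if } i<j,\qquad a^{\mathbf{w}}_{ii}=\sum_{k=1}^{i}a_{ik}+\sum_{k=i+1}^{n}w_{ik}^2a_{ik}.$$ The convolution is $$\det(X)\ast_W\det(Y)=\mathop{\mathbb{E}}_{\mathbf{w}_1,\mathbf{w}_2\in W^{\binom n2}}\det\big(X^{\mathbf{w}_1}+Y^{\mathbf{w}_2}\big),$$ where the expectation is the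 average over $\mathbf{w}_1,\mathbf{w}_2$ chosen independently and uniformly from $W^{\binom n2}$. It is a homogeneous polynomial of degree $n$ on the space of pairs of real symmetric $n\times n$ matrices. *)

(* Defs.v *)
From mathcomp Require Import all_boot all_order all_algebra.
From mathcomp Require Import finmap mpoly complex reals.

Set Implicit Arguments.
Unset Strict Implicit.
Unset Printing Implicit Defensive.

Import GRing.Theory Num.Theory.
Local Open Scope ring_scope.
Local Open Scope complex_scope.

(* All zeros of p in the complex numbers R[i] are real. *)
Definition real_rooted (R : realType) (p : {poly R}) : Prop :=
  forall z : R[i], root (map_poly (real_complex R) p) z -> z \is Num.real.

Definition hyperbolic (R : realType) (m : nat) (h : {mpoly R[m]})
    (e : 'I_m -> R) : Prop :=
  [/\ exists d : nat, h \is d.-homog,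
      h.@[e] != 0
    & forall x : 'I_m -> R,
        real_rooted (mmap (@polyC R) (fun k => e k *: 'X - (x k)%:P) h)].

(* The index set {(i, j) | i < j} of weights, of cardinality 'C(n, 2). *)
Definition edge (n : nat) := {ij : 'I_n * 'I_n | (ij.1 < ij.2)%N}.

(* The elements of W^('C(n, 2)). *)
Definition weights (R : realType) (W : {fset R}) (n : nat) :=
  {ffun edge n -> W}.

(* w_ij as a real number; the default 0 is only returned when j <= i, in which
   case the value is never used. *)
Definition weight (R : realType) (W : {fset R}) (n : nat) (w : weights W n)
    (i j : 'I_n) : R :=
  if insub (i, j) is Some ij then fsval (w ij) else 0.

(* A^w; entries are taken in an R-algebra S so that it applies both to real
   matrices and to matrices of indeterminates. *)
Definition weighting (R : realType) (W : {fset R}) (n : nat)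
    (S : comAlgType R) (A : 'M[S]_n) (w : weights W n) : 'M[S]_n :=
  \matrix_(i, j)
    if (i < j)%N then weight w i j *: A i j
    else if (j < i)%N then weight w j i *: A j i
    else \sum_(k < n | (k <= i)%N) A i k
         + \sum_(k < n | (i < k)%N) weight w i k ^+ 2 *: A i k.

(* det(X) *_W det(Y): the uniform average over pairs of weight vectors. *)
Definition conv_det (R : realType) (W : {fset R}) (n : nat)
    (S : comAlgType R) (X Y : 'M[S]_n) : S :=
  (#|{: weights W n * weights W n}|%:R : R)^-1 *:
    \sum_(w : weights W n * weights W n)
      \det (weighting X w.1 + weighting Y w.2).

Definition sym_index (n : nat) := {ij : 'I_n * 'I_n | (ij.1 <= ij.2)%N}.

Lemma sort_pair_subproof (n : nat) (i j : 'I_n) :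
  let ij := if (i <= j)%N then (i, j) else (j, i) in (ij.1 <= ij.2)%N.
Proof. by case: leqP => //= /ltnW. Qed.

Definition sort_pair (n : nat) (i j : 'I_n) : sym_index n :=
  exist _ (if (i <= j)%N then (i, j) else (j, i)) (sort_pair_subproof i j).

(* The indeterminates of R[x, y]: inl (i, j) is x_ij and inr (i, j) is y_ij,
   for i <= j. They are numbered by enum_rank to fit in {mpoly R[_]}. *)
Definition xyvar (n : nat) := (sym_index n + sym_index n)%type.

Definition nxy (n : nat) : nat := #|{: xyvar n}|.

Definition Xmx (R : realType) (n : nat) : 'M[{mpoly R[nxy n]}]_n :=
  \matrix_(i, j) 'X_(enum_rank (inl (sort_pair i j) : xyvar n)).

Definition Ymx (R : realType) (n : nat) : 'M[{mpoly R[nxy n]}]_n :=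
  \matrix_(i, j) 'X_(enum_rank (inr (sort_pair i j) : xyvar n)).

(* Coordinates of the pair A (+) B of symmetric matrices, read off their upper
   triangles. *)
Definition mx_point (R : realType) (n : nat) (A B : 'M[R]_n)
    (k : 'I_(nxy n)) : R :=
  match (enum_val k : xyvar n) with
  | inl s => A (val s).1 (val s).2
  | inr s => B (val s).1 (val s).2
  end.

(* Main.v *)
Require Import Defs.
From mathcomp Require Import all_boot all_order all_algebra.
From mathcomp Require Import perm finmap mpoly reals complex ring.

(* For symmetric A the weighting A^w is diag(A) + sum_(i<j) a_ij v^T v with the
   real row v = w_ij e_i + e_j, so det(X) *_W det(Y) averages det(Z + sum_e c_e
   v_e^T v_e) over independent random rows v_e. Add the edges one at a time: if
   Phi has no zero where Im Z > 0 and is affine along rank-one directions, then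
   Phi(Z + s v^T v) = Phi(Z) (1 + s q_v) has no zero for Im s >= 0, so q_v = 0
   or Im q_v < 0. Hence E_v Phi(Z + c v^T v) = Phi(Z) (1 + c E_v q_v) does not
   vanish either, for every real c of either sign. Finally h(z e - x) is such
   an average at a diagonal matrix with entries z - (real), so it has no zero
   with Im z > 0, and by conjugation none with Im z < 0. *)

Set Implicit Arguments.
Unset Strict Implicit.
Unset Printing Implicit Defensive.

Import Order.TTheory GRing.Theory Num.Theory.
Local Open Scope ring_scope.

(** * Rank-one updates and stability *)

(** Bordering turns the update into a Schur complement: the bordered determinant is linear in its
    first row (1, -s v) = (1, 0) + s (0, -v). The second part yields D, which is v adj(Z) v^T. *)
Lemma det_rank_one_affine (R : comNzRingType) (n : nat) (Z : 'M[R]_n)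
    (v : 'rV[R]_n) :
  exists D, forall s, \det (Z + s *: (v^T *m v)) = \det Z + s * D.
Proof.
exists (\det (block_mx (0 : 'M_1) (- v) v^T Z)) => s.
have -> : \det (Z + s *: (v^T *m v)) =
          \det (block_mx (1%:M : 'M_1) (- (s *: v)) v^T Z).
  have := congr1 determinant (mulmx_block (1%:M : 'M_1) (- (s *: v)) v^T Z
                                          1%:M (s *: v) 0 1%:M).
  rewrite det_mulmx det_ublock !det1 !mulr1 => ->.
  rewrite !mulmx1 !mulmx0 mul1mx addrN !addr0 -scalemxAr.
  by rewrite det_lblock det1 mul1r addrC.
have -> : \det Z = \det (block_mx (1%:M : 'M_1) 0 v^T Z).
  by rewrite det_lblock det1 mul1r.
rewrite -[X in X + _]mul1r.
apply: (@determinant_multilinear _ _ _ _ _ (lshift n 0)).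
- rewrite !rowKu !row_row_mx !row_id scale1r scale_row_mx add_row_mx.
  by rewrite scaler0 addr0 add0r scalerN.
- by rewrite /block_mx !row'Ku ![row' _ _]flatmx0.
- by rewrite /block_mx !row'Ku ![row' _ _]flatmx0.
Qed.

(* The imaginary part of u Z u^* is the value at u of the Hermitian form
   (Z - Z^* ) / 2i. *)
Definition upper_half (C : numClosedFieldType) (n : nat) (Z : 'M[C]_n) : Prop :=
  forall u : 'rV[C]_n, u != 0 ->
    0 < 'Im ((u *m Z *m (map_mx Num.conj u)^T) 0 0).

(** Affinity is part of the notion because it passes to averages and lets Phi along v be written
    Phi(Z) (1 + s q). *)
Definition stable (C : numClosedFieldType) (n : nat) (Phi : 'M[C]_n -> C) :
    Prop :=
  (forall Z, upper_half Z -> Phi Z != 0) /\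
  (forall (v : 'rV[C]_n) Z, exists D, forall s,
      Phi (Z + s *: (v^T *m v)) = Phi Z + s * D).

(** As v is real, u v^T v u^* equals |u v^T|^2, so the update adds Im s |u v^T|^2 >= 0 to the
    form. *)
Lemma upper_half_rank_one (C : numClosedFieldType) n (Z : 'M[C]_n)
    (v : 'rV[C]_n) s :
  upper_half Z -> (forall i, v 0 i \is Num.real) -> 0 <= 'Im s ->
  upper_half (Z + s *: (v^T *m v)).
Proof.
move=> hZ hv hs u u0; rewrite mulmxDr mulmxDl mxE raddfD /=.
apply: ltr_wpDr; last exact: hZ.
have -> : u *m (s *: (v^T *m v)) *m (map_mx Num.conj u)^T =
    s *: ((u *m v^T) *m (map_mx Num.conj (u *m v^T))^T).
  have vC : map_mx Num.conj v = v.
    by apply/rowP=> i; rewrite mxE; apply: conj_Creal.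
  rewrite map_mxM /= -map_trmx vC trmx_mul trmxK.
  by rewrite -scalemxAr -scalemxAl !mulmxA.
rewrite mxE mxE big_ord1 !mxE ImMr; last exact/ger0_real/mul_conjC_ge0.
exact/mulr_ge0/mul_conjC_ge0.
Qed.

(** A left kernel vector u of Z would give u Z u^* = 0. *)
Lemma stable_det (C : numClosedFieldType) n : stable (@determinant C n).
Proof.
split=> [Z hZ|v Z]; last exact: det_rank_one_affine.
apply/det0P=> -[u u0 uZ]; have := hZ u u0.
by rewrite uZ mul0mx mxE raddf0 ltxx.
Qed.

Lemma stable_scale (C : numClosedFieldType) n (a : C) (Phi : 'M[C]_n -> C) :
  a != 0 -> stable Phi -> stable (fun Z => a * Phi Z).
Proof.
move=> a0 [Phi0 PhiD]; split=> [Z /Phi0 hZ|v Z]; first exact: mulf_neq0.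
have [D hD] := PhiD v Z; exists (a * D) => s.
by rewrite hD mulrDr mulrCA.
Qed.

Lemma stable_ext (C : numClosedFieldType) n (Phi Psi : 'M[C]_n -> C) :
  Phi =1 Psi -> stable Phi -> stable Psi.
Proof.
move=> e [Phi0 PhiD]; split=> [Z|v Z]; first by rewrite -e; apply: Phi0.
by have [D hD] := PhiD v Z; exists D => s; rewrite -!e.
Qed.

(** The only zero in s is -1/q, whose imaginary part has the sign of Im q. *)
Lemma im_lt0_of_no_upper_zero (C : numClosedFieldType) (q : C) :
  (forall s, 0 <= 'Im s -> 1 + s * q != 0) -> q != 0 -> 'Im q < 0.
Proof.
move=> hq q0; rewrite real_ltNge ?Creal_Im //; apply/negP=> q_ge0.
suff /hq : 0 <= 'Im (- q^-1) by rewrite mulNr mulVf // subrr eqxx.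
by rewrite raddfN /= ImV mulNr opprK divr_ge0 // exprn_ge0.
Qed.

(** * Averages over random rank-one updates *)

Lemma stable_average (C : numClosedFieldType) n (V : finType) (c : C)
    (v : V -> 'rV[C]_n) (Phi : 'M[C]_n -> C) :
  c \is Num.real -> (forall x i, v x 0 i \is Num.real) -> (0 < #|V|)%N ->
  stable Phi ->
  stable (fun Z => \sum_(x : V) Phi (Z + c *: ((v x)^T *m v x))).
Proof.
move=> hc hv V0 [Phi0 PhiD]; split=> [Z hZ|u Z]; last first.
  have H x := PhiD u (Z + c *: ((v x)^T *m v x)).
  have [D hD] := fin_all_exists H.
  exists (\sum_x D x) => s; rewrite mulr_sumr -big_split; apply: eq_bigr=> x _ /=.
  by rewrite -hD addrAC.
have [D hD] := fin_all_exists (fun x => PhiD (v x) Z).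
have p0 := Phi0 Z hZ; set p := Phi Z in p0 hD.
pose q x := D x / p.
have Dq x : D x = p * q x by rewrite /q mulrC divfK.
have hq x s : 0 <= 'Im s -> 1 + s * q x != 0.
  move=> hs; have := Phi0 _ (upper_half_rank_one hZ (hv x) hs).
  by apply: contraNneq => h; rewrite hD Dq mulrCA -[X in X + _]mulr1 -mulrDr h mulr0.
have qle x : 'Im (q x) <= 0.
  have [->|/im_lt0_of_no_upper_zero h] := eqVneq (q x) 0; first by rewrite raddf0.
  exact/ltW/h/hq.
have -> : \sum_x Phi (Z + c *: ((v x)^T *m v x)) =
          p * (#|V|%:R + c * \sum_x q x).
  rewrite (eq_bigr (fun x => p * (1 + c * q x))); last first.
    by move=> x _; rewrite hD Dq mulrDr mulr1 mulrCA.
  by rewrite -mulr_sumr big_split /= sumr_const mulr_sumr.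
(* Were the second factor 0, then c sum_x Im q_x = 0 with c nonzero. All Im q_x are <= 0, so all
   vanish, which forces every q_x = 0 and leaves [#|V|] = 0. *)
rewrite mulf_eq0 negb_or p0 /=; apply/eqP=> h.
have V0' : #|V|%:R != 0 :> C by rewrite pnatr_eq0 -lt0n.
have c0 : c != 0 by apply/eqP=> c0; move: h; rewrite c0 mul0r addr0; apply/eqP.
have : 'Im (#|V|%:R + c * \sum_x q x) = 0 by rewrite h raddf0.
rewrite raddfD /= (Creal_ImP _ _) ?realn // add0r ImMl // => /eqP.
rewrite mulf_eq0 (negPf c0) /= raddf_sum /= => /eqP hs.
have q0 x : q x = 0.
  apply/eqP/negPn/negP => /im_lt0_of_no_upper_zero h1.
  have im_ge0 y : true -> 0 <= - 'Im (q y) by rewrite oppr_ge0.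
  have im_sum0 : \sum_y - 'Im (q y) = 0 by rewrite sumrN hs oppr0.
  have /eqP := psumr_eq0P im_ge0 im_sum0 (erefl : xpredT x).
  by rewrite oppr_eq0 (lt_eqF (h1 (hq x))).
move: h; rewrite big1 => [|x _]; last exact: q0.
by rewrite mulr0 addr0; apply/eqP.
Qed.

(** Exchanging x with [w i] is an involution on pairs, and [F x w] ignores [w i]. Coordinate i thus
    becomes an independent draw x, at the price of a factor [#|V|]. *)
Lemma sum_ffun_resample (I V : finType) (i : I) (M : zmodType)
    (F : V -> {ffun I -> V} -> M) :
  (forall x (w w' : {ffun I -> V}),
    (forall j, j != i -> w j = w' j) -> F x w = F x w') ->
  (\sum_(w : {ffun I -> V}) F (w i) w) *+ #|V| =
  \sum_(x : V) \sum_(w : {ffun I -> V}) F x w.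
Proof.
move=> hF; rewrite -sumr_const !pair_big_dep /=.
pose swap (p : V * {ffun I -> V}) :=
  (p.2 i, [ffun j => if j == i then p.1 else p.2 j]).
have swapK : involutive swap.
  case=> x w; rewrite /swap /= ffunE eqxx; congr (_, _); apply/ffunP=> j.
  by rewrite !ffunE; case: eqP => [->|].
rewrite (reindex_inj (inv_inj swapK)) /=; apply: eq_bigr=> -[x w] _ /=.
by rewrite ffunE eqxx; apply: hF => j ji; rewrite ffunE (negPf ji).
Qed.

Lemma stable_expectation (C : numClosedFieldType) n (I V : finType) (c : I -> C)
    (v : I -> V -> 'rV[C]_n) :
  (forall i, c i \is Num.real) -> (forall i x j, v i x 0 j \is Num.real) ->
  (0 < #|V|)%N ->
  stable (fun Z => \sum_(w : {ffun I -> V})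
    \det (Z + \sum_i c i *: ((v i (w i))^T *m v i (w i)))).
Proof.
move=> hc hv V0; have V0' : #|V|%:R != 0 :> C by rewrite pnatr_eq0 -lt0n.
pose g i x := c i *: ((v i x)^T *m v i x).
(* Induct on the list of updates present, with w always ranging over all of [{ffun I -> V}];
   [uniq s] keeps the coordinate of the head out of the tail. *)
suff: forall s : seq I, uniq s -> stable (fun Z => \sum_(w : {ffun I -> V})
    \det (Z + \sum_(i <- s) g i (w i))).
  move=> /(_ _ (index_enum_uniq _)); exact.
elim=> [_|i s IH /= /andP[is_ us]].
  apply: (@stable_ext _ _ (fun Z => #|{ffun I -> V}|%:R * \det Z)).
    move=> Z; rewrite (eq_bigr (fun=> \det Z)); last first.
      by move=> w _; rewrite big_nil addr0.
    by rewrite sumr_const mulr_natl.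
  apply: stable_scale (stable_det C n).
  by rewrite card_ffun natrX expf_neq0.
apply: stable_ext (stable_scale (invr_neq0 V0')
  (stable_average (hc i) (hv i) V0 (IH us))) => Z.
apply: (canLR (mulKf V0')).
rewrite mulr_natl; under [in RHS]eq_bigr do rewrite big_cons addrA.
rewrite -/(g i).
rewrite (@sum_ffun_resample _ _ i _
  (fun x w => \det (Z + g i x + \sum_(j <- s) g j (w j)))) //.
move=> x w w' hw; congr (\det (_ + _)); apply: eq_big_seq => j js.
by rewrite hw //; apply: contraNneq is_ => <-.
Qed.

(** * Weightings as sums of rank-one matrices *)

Definition edge_row (T : comNzRingType) n (e : edge n) (t : T) : 'rV[T]_n :=
  t *: delta_mx 0 (val e).1 + delta_mx 0 (val e).2.

Lemma map_edge_row (S T : comNzRingType) (phi : {rmorphism S -> T}) n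
    (e : edge n) t : map_mx phi (edge_row e t) = edge_row e (phi t).
Proof. by rewrite map_mxD map_mxZ !map_delta_mx. Qed.

Lemma weight_edge (R : realType) (W : {fset R}) n (w : weights W n) e :
  weight w (val e).1 (val e).2 = fsval (w e).
Proof. by rewrite /weight -surjective_pairing valK. Qed.

(* a^w_ii collects w_ik^2 a_ik for i < k and a_ki for k < i, which are the
   diagonal contributions of a_ik (w_ik e_i + e_k)^T (w_ik e_i + e_k). *)
Lemma weighting_rank_one (R : realType) (W : {fset R}) n (S : comAlgType R)
    (A : 'M[S]_n) (w : weights W n) :
  A^T = A ->
  weighting A w = diag_mx (\row_i A i i) +
    \sum_(e : edge n) A (val e).1 (val e).2 *:
      ((edge_row e (fsval (w e))%:A)^T *m edge_row e (fsval (w e))%:A).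
Proof.
move=> Asym; have symA k l : A k l = A l k by rewrite -[in LHS]Asym mxE.
apply/matrixP=> i j; rewrite !mxE summxE.
pose F (p : 'I_n * 'I_n) := A p.1 p.2 *
  (((weight w p.1 p.2)%:A * (i == p.1)%:R + (i == p.2)%:R) *
   ((weight w p.1 p.2)%:A * (j == p.1)%:R + (j == p.2)%:R)).
rewrite (eq_bigr (fun e : edge n => F (val e))); last first.
  by move=> e _; rewrite !mxE big_ord1 !mxE /F weight_edge !eqxx.
rewrite -(big_sub (fun p : 'I_n * 'I_n => p.1 < p.2)%N F).
rewrite -(pair_big_dep xpredT (fun k l : 'I_n => k < l)%N (fun k l => F (k, l))) /=.
pose x k l : S := (weight w k l)%:A.
have delta (i0 : 'I_n) (G : 'I_n -> S) : \sum_(k < n) (i0 == k)%:R * G k = G i0.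
  rewrite (bigD1 i0) //= eqxx mul1r big1 ?addr0 // => k.
  by rewrite eq_sym => /negPf ->; rewrite mul0r.
(* Expanding the two binomials gives four sums over k < l: the weighted diagonal at k, the entries
   above and below the diagonal, and the unweighted diagonal at l. *)
have -> : \sum_(k < n) \sum_(l < n | (k < l)%N) F (k, l) =
    \sum_(k < n) (i == k)%:R * ((j == k)%:R *
      \sum_(l < n | (k < l)%N) x k l ^+ 2 * A k l) +
    \sum_(k < n) (i == k)%:R * (\sum_(l < n) (j == l)%:R * ((k < l)%N%:R * (x k l * A k l))) +
    \sum_(k < n) (j == k)%:R * (\sum_(l < n) (i == l)%:R * ((k < l)%N%:R * (x k l * A k l))) +
    \sum_(l < n) (i == l)%:R * ((j == l)%:R * \sum_(k < n | (k < l)%N) A k l).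
  have -> : \sum_(l < n) (i == l)%:R * ((j == l)%:R * \sum_(k < n | (k < l)%N) A k l) =
      \sum_(k < n) \sum_(l < n | (k < l)%N) (i == l)%:R * ((j == l)%:R * A k l).
    rewrite (exchange_big_dep xpredT) //=.
    by apply: eq_bigr => l _; rewrite !mulr_sumr.
  rewrite -!big_split; apply: eq_bigr => k _ /=.
  rewrite !mulr_sumr !(big_mkcond (fun l : 'I_n => (k < l)%N)) /= -!big_split.
  apply: eq_bigr => l _ /=; rewrite /F /= -/(x k l).
  by case: ltnP => _ /=; ring.
rewrite !delta.
have xE k l : (weight w k l) *: A k l = x k l * A k l by rewrite mulr_algl.
have x2E k l : (weight w k l) ^+ 2 *: A k l = x k l ^+ 2 * A k l.
  by rewrite !expr2 -mulrA !mulr_algl scalerA.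
have [ij|ji|/val_inj <-] := ltngtP i j.
- by rewrite -[j == i]val_eqE -[i == j]val_eqE ltn_eqF ?gtn_eqF // xE /=; ring.
- by rewrite -[j == i]val_eqE -[i == j]val_eqE gtn_eqF ?ltn_eqF // xE /=; ring.
(* The term k = i of the sum over k <= i is the [diag_mx] entry; the terms k < i match the fourth
   sum by symmetry of A. *)
rewrite eqxx (bigD1 i) //= (eq_bigr _ (fun k _ => x2E i k)).
rewrite (eq_bigl (fun k : 'I_n => k < i)%N); last first.
  by move=> k; rewrite -val_eqE /= andbC -ltn_neqAle.
by rewrite (eq_bigr _ (fun k _ => symA k i)); ring.
Qed.

(** The left copy of the edges serves X, the right one Y: the independent pair of weight vectors
    becomes one function on the disjoint union, fit for a single induction. *)
Definition edge_val n (e : edge n + edge n) : edge n :=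
  match e with inl e => e | inr e => e end.

Definition edge_coef (T : Type) n (X Y : 'M[T]_n) (e : edge n + edge n) : T :=
  match e with
  | inl e => X (val e).1 (val e).2
  | inr e => Y (val e).1 (val e).2
  end.

(** Used for two morphisms: evaluation at e, with [iota] the identity, and restriction to a line
    followed by evaluation at a complex z, with [iota] the embedding of R. *)
Lemma rmorph_conv_det (R : realType) (W : {fset R}) n (S : comAlgType R)
    (T : comNzRingType) (phi : {rmorphism S -> T}) (iota : R -> T)
    (X Y : 'M[S]_n) :
  (forall a s, phi (a *: s) = iota a * phi s) -> X^T = X -> Y^T = Y ->
  phi (conv_det W X Y) =
  iota #|{: weights W n * weights W n}|%:R^-1 *
  \sum_(w : {ffun edge n + edge n -> W})
    \det (diag_mx (\row_i (phi (X i i) + phi (Y i i))) +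
          \sum_e edge_coef (map_mx phi X) (map_mx phi Y) e *:
            ((edge_row (edge_val e) (iota (fsval (w e))))^T *m
              edge_row (edge_val e) (iota (fsval (w e))))).
Proof.
move=> phiZ Xs Ys; rewrite /conv_det phiZ; congr (_ * _).
have phiA a : phi a%:A = iota a by rewrite phiZ rmorph1 mulr1.
pose split_w (w : {ffun edge n + edge n -> W}) : weights W n * weights W n :=
  ([ffun e => w (inl e)], [ffun e => w (inr e)]).
pose join_w (p : weights W n * weights W n) : {ffun edge n + edge n -> W} :=
  [ffun e => match e with inl e => p.1 e | inr e => p.2 e end].
rewrite raddf_sum (reindex split_w) /=; last first.
  exists join_w => [w _|[w1 w2] _].
    by apply/ffunP=> -[e|e]; rewrite !ffunE.
  by congr (_, _); apply/ffunP=> e; rewrite !ffunE.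
apply: eq_bigr=> w _; rewrite -det_map_mx; congr (\det _).
rewrite !weighting_rank_one // !map_mxD !map_diag_mx big_sumType /= !raddf_sum.
rewrite addrACA -raddfD /=; congr (diag_mx _ + (_ + _)).
- by apply/rowP=> i; rewrite !mxE.
- apply: eq_bigr=> e _.
  by rewrite map_mxZ map_mxM -map_trmx map_edge_row ffunE phiA mxE.
- apply: eq_bigr=> e _.
  by rewrite map_mxZ map_mxM -map_trmx map_edge_row ffunE phiA mxE.
Qed.

(** * Coordinates, homogeneity and the value at e *)

Lemma sort_pairC n (i j : 'I_n) : sort_pair i j = sort_pair j i.
Proof. by apply: val_inj => /=; case: ltngtP => // /val_inj ->. Qed.

Lemma sort_pair_entry (T : Type) n (A : 'M[T]_n) i j :
  A^T = A -> A (val (sort_pair i j)).1 (val (sort_pair i j)).2 = A i j.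
Proof. by move=> As /=; case: leqP => //= _; rewrite -[in LHS]As mxE. Qed.

Lemma mx_point_X (R : realType) n (A B : 'M[R]_n) i j : A^T = A ->
  mx_point A B (enum_rank (inl (sort_pair i j) : xyvar n)) = A i j.
Proof. by move=> As; rewrite /mx_point enum_rankK sort_pair_entry. Qed.

Lemma mx_point_Y (R : realType) n (A B : 'M[R]_n) i j : B^T = B ->
  mx_point A B (enum_rank (inr (sort_pair i j) : xyvar n)) = B i j.
Proof. by move=> Bs; rewrite /mx_point enum_rankK sort_pair_entry. Qed.

Lemma Xmx_sym (R : realType) n : (Xmx R n)^T = Xmx R n.
Proof. by apply/matrixP=> i j; rewrite !mxE sort_pairC. Qed.

Lemma Ymx_sym (R : realType) n : (Ymx R n)^T = Ymx R n.
Proof. by apply/matrixP=> i j; rewrite !mxE sort_pairC. Qed.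

Lemma card_weights_neq0 (R : realType) (W : {fset R}) n :
  W != fset0 -> #|{: weights W n * weights W n}|%:R != 0 :> R.
Proof.
move=> W0; rewrite pnatr_eq0 -lt0n card_prod muln_gt0 andbb.
by rewrite card_ffun expn_gt0 -cardfE cardfs_gt0 W0 orTb.
Qed.

Lemma det_homog (R : realType) m n (M : 'M[{mpoly R[m]}]_n) :
  (forall i j, M i j \is 1.-homog) -> \det M \is n.-homog.
Proof.
move=> hM; apply: rpred_sum => s _; rewrite -signr_odd mulr_sign.
have prod_homog (r : seq 'I_n) : \prod_(i <- r) M i (s i) \is (size r).-homog.
  elim: r => [|i r IH]; first by rewrite big_nil dhomog1.
  by rewrite big_cons /= -add1n dhomogM.
have := prod_homog (index_enum 'I_n).
rewrite -sum1_size sum1_card card_ord => h.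
by case: ifP => _ //; rewrite rpredN.
Qed.

Lemma weighting_homog (R : realType) (W : {fset R}) m n
    (A : 'M[{mpoly R[m]}]_n) (w : weights W n) i j :
  (forall i j, A i j \is 1.-homog) -> weighting A w i j \is 1.-homog.
Proof.
move=> hA; rewrite mxE; case: ifP => _; first exact: rpredZ.
case: ifP => _; first exact: rpredZ.
by apply: rpredD; apply: rpred_sum => k _; rewrite ?rpredZ.
Qed.

Lemma conv_det_homog (R : realType) (W : {fset R}) n :
  conv_det W (Xmx R n) (Ymx R n) \is n.-homog.
Proof.
apply/rpredZ/rpred_sum => w _; apply: det_homog => i j; rewrite mxE.
by apply: rpredD; apply: weighting_homog => {}i {}j; rewrite mxE dhomogX /= mdeg1.
Qed.

(** At (I, 0) every edge coefficient is an off-diagonal entry, hence 0, so each determinant averaged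
    is det I. *)
Lemma conv_det_at_identity (R : realType) (W : {fset R}) n : W != fset0 ->
  (conv_det W (Xmx R n) (Ymx R n)).@[mx_point 1%:M 0] = 1.
Proof.
move=> W0; set e := mx_point _ _.
rewrite (@rmorph_conv_det _ W n _ _ (meval e) id) ?Xmx_sym ?Ymx_sym //;
  last exact: mevalZ.
have eX i j : meval e (Xmx R n i j) = (i == j)%:R.
  by rewrite mxE mevalXU /e mx_point_X ?trmx1 ?mxE.
have eY i j : meval e (Ymx R n i j) = 0.
  by rewrite mxE mevalXU /e mx_point_Y ?trmx0 ?mxE.
rewrite (eq_bigr (fun=> 1)) => [|w _].
  rewrite sumr_const -[_ *+ _]/(_%:R).
  have -> : #|{ffun edge n + edge n -> W}| = #|{: weights W n * weights W n}|.
    by rewrite card_prod !card_ffun card_sum expnD.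
  by rewrite mulVf ?card_weights_neq0.
rewrite [X in _ + X]big1 => [|ed _].
  rewrite addr0 -[RHS](det1 _ n) -diag_const_mx; congr (\det (diag_mx _)).
  by apply/rowP=> i; rewrite mxE /= eX eY eqxx addr0 mxE.
case: ed => ed /=; rewrite mxE ?eX ?eY ?scale0r //.
by rewrite -val_eqE ltn_eqF ?(valP ed) //= scale0r.
Qed.

(** * Excluding non-real zeros *)

Lemma real_rooted_upper (R : realType) (p : {poly R}) :
  (forall z : R[i], 0 < 'Im z -> ~~ root (map_poly (real_complex R) p) z) ->
  real_rooted p.
Proof.
move=> hp z pz; apply/Creal_ImP/eqP.
have pzC : root (map_poly (real_complex R) p) (Num.conj z).
  rewrite -complex_root_conj -map_poly_comp.
  rewrite (@eq_map_poly _ _ _ (real_complex R)) // => a /=.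
  by rewrite oppr0.
have ImR y : 'Im y \is Num.real := Creal_Im y.
rewrite eq_le !real_leNgt ?real0 ?ImR //; apply/andP; split.
- by apply: contraL pz => /hp.
- by apply: contraL pzC => z0; apply: hp; rewrite Im_conj oppr_gt0.
Qed.

(** The form is the sum of |u_i|^2 Im d_i. *)
Lemma upper_half_diag (C : numClosedFieldType) n (d : 'rV[C]_n) :
  (forall i, 0 < 'Im (d 0 i)) -> upper_half (diag_mx d).
Proof.
move=> hd u u0; rewrite mul_mx_diag mxE raddf_sum /=.
have E i : 'Im ((\matrix_(i0, j) (u i0 j * d 0 j)) 0 i *
    (map_mx Num.conj u)^T i 0) = `|u 0 i| ^+ 2 * 'Im (d 0 i).
  rewrite !mxE mulrAC -normCK ImMl //.
  by rewrite realX // normr_real.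
rewrite (eq_bigr _ (fun i _ => E i)).
have /rV0Pn[i ui] := u0.
have term_ge0 j : 0 <= `|u 0 j| ^+ 2 * 'Im (d 0 j).
  by rewrite mulr_ge0 ?exprn_ge0 // ltW.
rewrite (bigD1 i) //= ltr_wpDr ?sumr_ge0 // mulr_gt0 //.
by rewrite exprn_gt0 // normr_gt0.
Qed.

Theorem proposition4p2 (R : realType) (n : nat) (hn : (1 <= n)%N)
    (W : {fset R}) (hW : W != fset0) :
  hyperbolic (conv_det W (Xmx R n) (Ymx R n)) (mx_point 1%:M 0).
Proof.
split; first by exists n; apply: conv_det_homog.
  by rewrite conv_det_at_identity ?oner_neq0.
move=> x; apply: real_rooted_upper => z z_gt0.
set e := mx_point _ _; set f := fun k => _.
(* [phi] is h -> h(z e - x), a ring morphism sending the k-th indeterminate to e_k z - x_k. *)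
pose phi : {rmorphism {mpoly R[nxy n]} -> R[i]} :=
  horner_eval z \o map_poly (real_complex R) \o mmap (@polyC R) f.
rewrite /root -[X in X != 0]/(phi (conv_det W (Xmx R n) (Ymx R n))).
have phiZ a s : phi (a *: s) = real_complex R a * phi s.
  by rewrite /phi /= mmapZ rmorphM /= map_polyC /horner_eval hornerM hornerC.
have phiX k : phi 'X_k = real_complex R (e k) * z - real_complex R (x k).
  rewrite /phi /= mmapX mmap1U /f /horner_eval rmorphB /= map_polyC.
  by rewrite linearZ /= map_polyX !hornerE.
rewrite (rmorph_conv_det W phiZ) ?Xmx_sym ?Ymx_sym //.
rewrite mulf_neq0 //; first by rewrite fmorph_eq0 invr_neq0 ?card_weights_neq0.
have real_real a : real_complex R a \is Num.real by apply/complex_realP; exists a.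
have phiXmx i j : phi (Xmx R n i j) = (i == j)%:R * z -
    real_complex R (x (enum_rank (inl (sort_pair i j) : xyvar n))).
  by rewrite mxE phiX /e mx_point_X ?trmx1 // mxE rmorph_nat.
have phiYmx i j : phi (Ymx R n i j) =
    - real_complex R (x (enum_rank (inr (sort_pair i j) : xyvar n))).
  by rewrite mxE phiX /e mx_point_Y ?trmx0 // mxE rmorph0 mul0r add0r.
have edge_neq (ed : edge n) : ((val ed).1 == (val ed).2) = false.
  by rewrite -val_eqE ltn_eqF ?(valP ed).
(* Since e = (I, 0), z enters only the diagonal of X; the edge coefficients are therefore real, of
   either sign. *)
set c := edge_coef _ _.
have hc ed : c ed \is Num.real.
  case: ed => ed; rewrite /c /= mxE ?phiXmx ?phiYmx ?edge_neq ?mul0r ?add0r.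
    by rewrite rpredN.
  by rewrite rpredN.
have hv (ed : edge n + edge n) (t : W) j :
    edge_row (edge_val ed) (real_complex R (fsval t)) 0 j \is Num.real.
  by rewrite !mxE rpredD ?rpredM ?realn.
have W_gt0 : (0 < #|{: W}|)%N by rewrite -cardfE cardfs_gt0.
have [+ _] := stable_expectation hc hv W_gt0.
(* The i-th diagonal entry is z - x_ii - y_ii, with imaginary part Im z. *)
apply; apply: upper_half_diag => i; rewrite mxE phiXmx phiYmx eqxx mul1r.
by rewrite !raddfD !raddfN /= !(Creal_ImP _ (real_real _)) !oppr0 !addr0.
Qed.
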